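(* Let $\mathcal{S}_\tau$ be an admissible supercritical regime (in density-energy coordinates) and set $\mathcal{S}_U=\Theta(\mathcal{S}_\tau\times\mathbb{R})$. A numerical flux $\boldsymbol{f}_h:\mathcal{S}_U\times\mathcal{S}_U\to\mathbb{R}^3$ that is consistent and algebraically pressure-equilibrium-preserving exists if and only if for every $P\in\mathbb{R}_+$ such that the isobar $\Gamma_P$ is nonempty one has $$L_{\boldsymbol{\tau}_1}\Gamma_P\cap L_{\boldsymbol{\tau}_2}\Gamma_P\neq\varnothing\qquad\text{for all }\boldsymbol{\tau}_1,\boldsymbol{\tau}_2\in\Gamma_P .$$
   Context: **Equation of state.** Fix $\sigma_{\min}\in\mathbb{R}$ and let $\mathcal{T}=\{(\nu,\sigma)\in\mathbb{R}^2:\nu>0,\ \sigma\ge\sigma_{\min}\}$. An equation of state is a function $e:\mathcal{T}\to\mathbb{R}$ that is $C^1$ and piecewise twice continuously differentiable. Subscripts denote partial derivatives. Pressure and temperature in $(\nu,\sigma)$-coordinates are $\hat p:=-e_\nu$ and $T:=e_\sigma$. $\mathbb{R}_+$ denotes the positive reals. **Admissible supercritical regime.** A nonempty set $\mathcal{S}_\eta\subset\operatorname{int}(\mathcal{T})$, open in $\mathbb{R}^2$, is an admissible supercritical regime if: (1) $e\in C^2(\mathcal{S}_\eta)$; (2) $\hat p>0$ and $T>0$ on $\mathcal{S}_\eta$, and for each fixed $\nu$ the map $\sigma\mapsto e(\nu,\sigma)$ is injective on $\{\sigma:(\nu,\sigma)\in\mathcal{S}_\eta\}$; (3) $e_{\nu\nu}>0$,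 $e_{\sigma\sigma}>0$ and $e_{\nu\nu}e_{\sigma\sigma}>(e_{\nu\sigma})^2$ on $\mathcal{S}_\eta$. **Density-energy coordinates.** $\Phi:\mathcal{S}_\eta\to\mathbb{R}^2$, $\Phi(\nu,\sigma)=(1/\nu,\ e(\nu,\sigma)/\nu)=:(\rho,\varepsilon)$, is a $C^2$ diffeomorphism onto its image $\mathcal{S}_\tau:=\Phi(\mathcal{S}_\eta)$, which is called an admissible supercritical regime in density-energy coordinates; its points are $\boldsymbol{\tau}=(\rho,\varepsilon)$. The pressure on $\mathcal{S}_\tau$ is $p(\boldsymbol{\tau}):=\hat p(\Phi^{-1}(\boldsymbol{\tau}))$; it is $C^1$ with nowhere vanishing gradient. **Isobars and tangent lines.** For $P\in\mathbb{R}_+$, $\Gamma_P:=\{\boldsymbol{\tau}\in\mathcal{S}_\tau:p(\boldsymbol{\tau})=P\}$. Near each of its points $\Gamma_P$ has a regular local $C^1$ parameterization $\varphi:I\to\Gamma_P$ ($I$ an open interval, $\varphi'\ne 0$). For $\boldsymbol{\tau}=\varphi(t)\in\Gamma_P$, the tangent space is $T_{\boldsymbol{\tau}}\Gamma_P:=\operatorname{span}(\varphi'(t))\subset\mathbb{R}^2$ (independent of $\varphi$), and the tangent line is $L_{\boldsymbol{\tau}}\Gamma_P:=\boldsymbol{\tau}+T_{\boldsymbol{\tau}}\Gamma_P$. **Conservative variables.** $\Theta:\mathcal{S}_\tau\times\mathbb{R}\to\mathbb{R}^3$, $\Theta((\rho,\varepsilon),v)=(\rho,\ \rho v,\ \varepsilon+\tfrac12\rho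 v^2)$, and $\mathcal{S}_U:=\Theta(\mathcal{S}_\tau\times\mathbb{R})$, an open set with points $\boldsymbol{U}=(\rho,m,E)$. Put $v(\boldsymbol{U})=m/\rho$, $\varepsilon(\boldsymbol{U})=E-\tfrac12 m^2/\rho$, $\boldsymbol{\tau}(\boldsymbol{U})=(\rho,\varepsilon(\boldsymbol{U}))$. The Euler flux is $\boldsymbol{f}(\boldsymbol{U})=(\rho v,\ \rho v^2+p,\ v(E+p))$ with $v=v(\boldsymbol{U})$, $p=p(\boldsymbol{\tau}(\boldsymbol{U}))$. For $P\in\mathbb{R}_+$, $V\in\mathbb{R}$ let $\mathcal{M}_{P,V}:=\{\boldsymbol{U}\in\mathcal{S}_U:p(\boldsymbol{\tau}(\boldsymbol{U}))=P,\ v(\boldsymbol{U})=V\}$. **Numerical fluxes.** A numerical flux is any function $\boldsymbol{f}_h:\mathcal{S}_U\times\mathcal{S}_U\to\mathbb{R}^3$ (no regularity assumed). It is consistent if $\boldsymbol{f}_h(\boldsymbol{U},\boldsymbol{U})=\boldsymbol{f}(\boldsymbol{U})$ for all $\boldsymbol{U}\in\mathcal{S}_U$. Write $\Delta\boldsymbol{f}_h(\boldsymbol{U}_R,\boldsymbol{U}_C,\boldsymbol{U}_L):=\boldsymbol{f}_h(\boldsymbol{U}_R,\boldsymbol{U}_C)-\boldsymbol{f}_h(\boldsymbol{U}_C,\boldsymbol{U}_L)$. A consistent numerical flux is algebraically pressure-equilibrium-preserving if for every $P\in\mathbb{R}_+$, $V\in\mathbb{R}$ and all $\boldsymbol{U}_R,\boldsymbol{U}_C,\boldsymbol{U}_L\in\mathcal{M}_{P,V}$: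 $$\nabla v(\boldsymbol{U}_C)^T\Delta\boldsymbol{f}_h(\boldsymbol{U}_R,\boldsymbol{U}_C,\boldsymbol{U}_L)=0,\qquad \nabla p(\boldsymbol{\tau}(\boldsymbol{U}_C))^TD\boldsymbol{\tau}(\boldsymbol{U}_C)\,\Delta\boldsymbol{f}_h(\boldsymbol{U}_R,\boldsymbol{U}_C,\boldsymbol{U}_L)=0,$$ where $D\boldsymbol{\tau}$ is the Jacobian of $\boldsymbol{U}\mapsto\boldsymbol{\tau}(\boldsymbol{U})$. *)

(* Defs.v *)
From HB Require Import structures.
From mathcomp Require Import all_boot all_order all_algebra.
From mathcomp Require Import all_classical all_reals all_analysis.

Set Implicit Arguments.
Unset Strict Implicit.
Unset Printing Implicit Defensive.
Import Order.TTheory GRing.Theory Num.Theory.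
Import numFieldNormedType.Exports.

Local Open Scope classical_set_scope.
Local Open Scope ring_scope.

(* Points of R^2 and R^3 are row vectors. The relevant points are (nu, sigma)
   (specific volume, entropy), tau = (rho, eps) (density, internal energy per
   unit volume) and U = (rho, m, E). Functions that the mathematics defines
   only on a subset (e, the pressure, numerical fluxes) are total here; their
   values outside that subset are irrelevant. *)

Section Calculus.
Context {R : realType}.

Definition row2 (a b : R) : 'rV[R]_2 := \row_i [:: a; b]`_i.
Definition row3 (a b c : R) : 'rV[R]_3 := \row_i [:: a; b; c]`_i.

Definition dot n (u w : 'rV[R]_n) : R := \sum_i u 0 i * w 0 i.

Definition partial n (i : 'I_n) (f : 'rV[R]_n -> R) (x : 'rV[R]_n) : R :=
  'D_(delta_mx 0 i) f x.

Definition grad n (f : 'rV[R]_n -> R) (x : 'rV[R]_n) : 'rV[R]_n :=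
  \row_i partial i f x.

(* Meant for an open set A. *)
Definition C1_on n (A : set 'rV[R]_n) (f : 'rV[R]_n -> R) : Prop :=
  forall x, A x ->
    differentiable f x /\ forall i, {for x, continuous (partial i f)}.

Definition C2_on n (A : set 'rV[R]_n) (f : 'rV[R]_n -> R) : Prop :=
  C1_on A f /\ forall i, C1_on A (partial i f).

(* C^1 up to the part of the boundary of A that belongs to A: the first partial
   derivatives, taken in the interior, extend continuously to A. *)
Definition C1_upto_boundary n (A : set 'rV[R]_n) (f : 'rV[R]_n -> R) : Prop :=
  {within A, continuous f} /\
  exists g : 'I_n -> 'rV[R]_n -> R,
    (forall i, {within A, continuous (g i)}) /\
    (forall x, A° x ->
       differentiable f x /\ forall i, partial i f x = g i x).

(* The pieces are open, pairwise disjoint and locally finite in A, and their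
   closures cover A; some of the D k may be empty, so finite families are
   included. No regularity is asked of the second derivatives at the boundary
   of a piece. *)
Definition piecewise_C2 n (A : set 'rV[R]_n) (f : 'rV[R]_n -> R) : Prop :=
  exists D : nat -> set 'rV[R]_n,
    [/\ (forall k, [/\ open (D k), D k `<=` A & C2_on (D k) f]),
        trivIset setT D,
        (forall x, A x ->
           exists2 W, nbhs x W & finite_set [set k | D k `&` W !=set0]) &
        A `<=` \bigcup_k closure (D k)].

End Calculus.

Section EquationOfState.
Context {R : realType}.
Implicit Types (sigma_min : R) (e : 'rV[R]_2 -> R) (S : set 'rV[R]_2).

Definition eos_domain sigma_min : set 'rV[R]_2 :=
  [set x | 0 < x 0 0 /\ sigma_min <= x 0 1].

Definition equation_of_state sigma_min e : Prop :=
  C1_upto_boundary (eos_domain sigma_min) e /\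
  piecewise_C2 (eos_domain sigma_min) e.

Definition phat e (x : 'rV[R]_2) : R := - partial 0 e x.
Definition temperature e (x : 'rV[R]_2) : R := partial 1 e x.

Record admissible_regime sigma_min e S : Prop := AdmissibleRegime {
  regime_nonempty : S !=set0 ;
  regime_open : open S ;
  regime_sub : S `<=` (eos_domain sigma_min)° ;
  regime_C2 : C2_on S e ;
  regime_phat_gt0 : forall x, S x -> 0 < phat e x ;
  regime_temperature_gt0 : forall x, S x -> 0 < temperature e x ;
  regime_inj : forall nu sigma sigma',
    S (row2 nu sigma) -> S (row2 nu sigma') ->
    e (row2 nu sigma) = e (row2 nu sigma') -> sigma = sigma' ;
  regime_nunu_gt0 : forall x, S x -> 0 < partial 0 (partial 0 e) x ;
  regime_sigmasigma_gt0 : forall x, S x -> 0 < partial 1 (partial 1 e) x ;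
  regime_hessian : forall x, S x ->
    partial 1 (partial 0 e) x ^+ 2 <
    partial 0 (partial 0 e) x * partial 1 (partial 1 e) x }.

Definition Phi e (x : 'rV[R]_2) : 'rV[R]_2 :=
  row2 (x 0 0)^-1 (e x / x 0 0).

Definition S_tau e S : set 'rV[R]_2 := Phi e @` S.

(* The inverse of Phi on S_tau is the library's partial inverse; it is a
   genuine inverse there since Phi is injective on an admissible regime. *)
Definition pressure e S (tau : 'rV[R]_2) : R :=
  phat e ('pinv_(fun=> 0) S (Phi e) tau).

Definition isobar e S (P : R) : set 'rV[R]_2 :=
  [set tau | S_tau e S tau /\ pressure e S tau = P].

End EquationOfState.

Section Tangent.
Context {R : realType}.
Implicit Types (Gamma : set 'rV[R]_2) (tau : 'rV[R]_2).

(* phi : I -> Gamma is C^1 with nowhere vanishing derivative on the open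
   interval I, and its image is a neighbourhood of tau in Gamma. *)
Record local_parameterization Gamma tau (I : set R) (phi : R -> 'rV[R]_2) :
    Prop := LocalParameterization {
  param_open : open I ;
  param_interval : is_interval I ;
  param_sub : phi @` I `<=` Gamma ;
  param_derivable : forall t, I t -> derivable phi t 1 ;
  param_C1 : forall t, I t -> {for t, continuous ('D_1 phi)} ;
  param_regular : forall t, I t -> 'D_1 phi t != 0 ;
  param_cover : \forall x \near tau, Gamma x -> (phi @` I) x }.

(* Union of the spans of phi'(t) over all local parameterizations with
   phi(t) = tau; on the isobars of an admissible regime all these spans
   coincide. *)
Definition tangent_space Gamma tau : set 'rV[R]_2 :=
  [set w | exists (I : set R) (phi : R -> 'rV[R]_2) (t c : R),
     [/\ local_parameterization Gamma tau I phi, I t, phi t = tau &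
         w = c *: 'D_1 phi t]].

Definition tangent_line Gamma tau : set 'rV[R]_2 :=
  [set tau + w | w in tangent_space Gamma tau].

End Tangent.

Section Fluxes.
Context {R : realType}.
Implicit Types (e : 'rV[R]_2 -> R) (S : set 'rV[R]_2) (U : 'rV[R]_3).
Implicit Types (fh : 'rV[R]_3 -> 'rV[R]_3 -> 'rV[R]_3).

Definition Theta (tau : 'rV[R]_2) (v : R) : 'rV[R]_3 :=
  row3 (tau 0 0) (tau 0 0 * v) (tau 0 1 + 2^-1 * tau 0 0 * v ^+ 2).

Definition S_U e S : set 'rV[R]_3 :=
  [set U | exists tau v, S_tau e S tau /\ U = Theta tau v].

Definition velocity U : R := U 0 1 / U 0 0.

Definition tau_of U : 'rV[R]_2 :=
  row2 (U 0 0) (U 0 2 - 2^-1 * (U 0 1 ^+ 2 / U 0 0)).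

Definition euler_flux e S U : 'rV[R]_3 :=
  let v := velocity U in
  let p := pressure e S (tau_of U) in
  row3 (U 0 0 * v) (U 0 0 * v ^+ 2 + p) (v * (U 0 2 + p)).

Definition equilibrium_states e S (P V : R) : set 'rV[R]_3 :=
  [set U | [/\ S_U e S U, pressure e S (tau_of U) = P & velocity U = V]].

Definition consistent e S fh : Prop :=
  forall U, S_U e S U -> fh U U = euler_flux e S U.

Definition flux_difference fh (UR UC UL : 'rV[R]_3) : 'rV[R]_3 :=
  fh UR UC - fh UC UL.

(* The library's Jacobian 'J acts on row vectors from the right, so
   D tau(U) d is written  d *m 'J tau_of U. *)
Definition pressure_equilibrium_preserving e S fh : Prop :=
  forall P V, 0 < P -> forall UR UC UL : 'rV[R]_3,
    equilibrium_states e S P V UR ->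
    equilibrium_states e S P V UC ->
    equilibrium_states e S P V UL ->
    dot (grad velocity UC) (flux_difference fh UR UC UL) = 0 /\
    dot (grad (pressure e S) (tau_of UC))
        (flux_difference fh UR UC UL *m 'J tau_of UC) = 0.

End Fluxes.

(* Main.v *)
Require Import Defs.
From HB Require Import structures.
From mathcomp Require Import all_boot all_order all_algebra.
From mathcomp Require Import all_classical all_reals all_analysis.
From mathcomp Require Import ring lra.
Import Order.TTheory GRing.Theory Num.Theory.
Import numFieldNormedType.Exports.
Local Open Scope classical_set_scope.
Local Open Scope ring_scope.

Set Implicit Arguments.
Unset Strict Implicit.
Unset Printing Implicit Defensive.

(** Fix P and V. The states with pressure P and velocity V are parameterized by
    the points tau of the isobar Gamma_P. For an increment d = (d0, d1, d2) of
    the conservative variables at such a state, preservation of the velocity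
    says d1 = V d0; granted this, preservation of the pressure says that the
    reduced increment (d0, d2 - V^2 d0 / 2) is annihilated by the differential
    of p at tau, that is, that it is tangent to Gamma_P
    ([equilibrium_preserved_tangent]). The Euler flux itself reduces to
    V (tau + (0, P)) ([reduced_euler_flux]).

    Let fh be consistent and preserving, and take V = 1. Write g for the
    reduction of fh(U1, U2). The triple (U1, U1, U2) shows that
    tau1 + (0, P) - g is tangent at tau1, and the triple (U1, U2, U2) that
    g - tau2 - (0, P) is tangent at tau2. So g - (0, P) lies on both tangent
    lines ([preserving_tangent_lines_meet]).

    Conversely, choose a point q(tau1, tau2) on both tangent lines, with
    q(tau, tau) = tau, and let fh(U1, U2) be the vector that reduces to
    V (q(tau1, tau2) + (0, P)) and has second component V fh_1 + P. The choice
    on the diagonal gives consistency. On a triple, q(tau_R, tau_C) and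
    q(tau_C, tau_L) both lie on the tangent line at tau_C, hence their
    difference is tangent there ([meeting_flux_preserving]).

    What remains is analysis: the tangent space of an isobar is the kernel of
    the differential of p ([tangent_spaceE]). This needs p to be
    differentiable, hence Phi to have a differentiable inverse, and isobars to
    have regular C^1 parameterizations. Both follow from an inverse function
    theorem for maps that keep one coordinate, or a function of it, and are
    strictly increasing along the other one: Phi, where e increases with the
    entropy, and (nu, sigma) |-> (e_nu, sigma), where e_nu increases with the
    volume. For these the intermediate value theorem gives openness
    ([solve_along]), openness and injectivity give continuity of the inverse,
    and continuity of the inverse gives its differentiability
    ([differentiable_inverse]). The second map straightens the curve
    e_nu = - P, of which the isobar is the image under Phi. *)

(** * Row vectors and their differentials *)

Lemma rV2P (R : realType) (u w : 'rV[R]_2) : u 0 0 = w 0 0 -> u 0 1 = w 0 1 -> u = w.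
Proof.
move=> h0 h1; apply/rowP => i.
by case: (unliftP ord0 i) => [j ->|->//]; rewrite (ord1 j) (_ : lift _ _ = 1) //; apply/val_inj.
Qed.

Lemma row2E0 (R : realType) (a b : R) : row2 a b 0 0 = a.
Proof. by rewrite mxE. Qed.

Lemma row2E1 (R : realType) (a b : R) : row2 a b 0 1 = b.
Proof. by rewrite mxE. Qed.

Lemma row2_delta (R : realType) (a b : R) :
  row2 a b = a *: delta_mx 0 0 + b *: delta_mx 0 1.
Proof. by apply: rV2P; rewrite !mxE /=; ring. Qed.

Lemma row2_eta (R : realType) (w : 'rV[R]_2) : row2 (w 0 0) (w 0 1) = w.
Proof. by apply: rV2P; rewrite mxE. Qed.

Lemma linear_row2 (R : realType) (V : lmodType R) (l : {linear 'rV[R]_2 -> V}) w :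
  l w = w 0 0 *: l (delta_mx 0 0) + w 0 1 *: l (delta_mx 0 1).
Proof. by rewrite -[in LHS](row2_eta w) row2_delta linearD !linearZ. Qed.

Lemma ker_form_line (R : realType) (l : {linear 'rV[R]_2 -> R}) (u w : 'rV[R]_2) :
  (exists k, l k != 0) -> u != 0 -> l u = 0 -> l w = 0 -> exists c, w = c *: u.
Proof.
move=> [k]; rewrite (linear_row2 l k) (linear_row2 l u) (linear_row2 l w).
set a := l (delta_mx 0 0); set b := l (delta_mx 0 1) => dk u0 du dw.
(* Otherwise u and w would be independent and l would vanish. *)
have det : u 0 0 * w 0 1 = u 0 1 * w 0 0.
  have A : a * (u 0 0 * w 0 1 - u 0 1 * w 0 0) = 0.
    transitivity (w 0 1 * (u 0 0 * a + u 0 1 * b) - u 0 1 * (w 0 0 * a + w 0 1 * b)).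
      by ring.
    by rewrite [X in _ * X - _]du [X in _ - _ * X]dw !mulr0 subrr.
  have B : b * (u 0 0 * w 0 1 - u 0 1 * w 0 0) = 0.
    transitivity (u 0 0 * (w 0 0 * a + w 0 1 * b) - w 0 0 * (u 0 0 * a + u 0 1 * b)).
      by ring.
    by rewrite [X in _ * X - _]dw [X in _ - _ * X]du !mulr0 subrr.
  apply/eqP; rewrite -subr_eq0; apply: contraT => D.
  move/eqP : A; rewrite mulf_eq0 (negPf D) orbF => /eqP a0.
  move/eqP : B; rewrite mulf_eq0 (negPf D) orbF => /eqP b0.
  by move: dk; rewrite a0 b0 !scaler0 addr0 eqxx.
have [u00|u00] := eqVneq (u 0 0) 0.
  have u01 : u 0 1 != 0.
    by apply: contra u0 => /eqP u01; apply/eqP/rV2P; rewrite mxE.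
  exists (w 0 1 / u 0 1); apply: rV2P; rewrite mxE ?divfK //.
  move/eqP : det; rewrite u00 mul0r mulr0 eq_sym mulf_eq0 (negPf u01) /= => /eqP //.
exists (w 0 0 / u 0 0); apply: rV2P; rewrite mxE ?divfK //.
by apply: (mulfI u00); rewrite det; field.
Qed.

Lemma is_diff_row2 (R : realType) (V : normedModType R) (a b da db : V -> R) x :
  is_diff x a da -> is_diff x b db ->
  is_diff x (fun y => row2 (a y) (b y)) (fun y => row2 (da y) (db y)).
Proof.
move=> ha hb; under [X in is_diff _ X _]eq_fun do rewrite row2_delta.
under [X in is_diff _ _ X]eq_fun do rewrite row2_delta.
have h v (c dc : V -> R) : is_diff x c dc ->
    is_diff x (fun y => c y *: v : 'rV[R]_2) (fun y => dc y *: v).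
  move=> hc; have hd : differentiable c x by exact: ex_diff.
  apply: DiffDef; first exact: differentiableZl.
  by rewrite diffZl //; apply/funext => y; rewrite diff_val.
exact: is_diffD.
Qed.

Lemma continuous_row2 (R : realType) (V : normedModType R) (a b : V -> R) x :
  {for x, continuous a} -> {for x, continuous b} ->
  {for x, continuous (fun y => row2 (a y) (b y))}.
Proof.
move=> ha hb; rewrite /prop_for /continuous_at row2_delta.
under [X in X @ _]eq_fun do rewrite row2_delta.
by apply: cvgD; apply: cvgZr_tmp.
Qed.

Lemma dot_grad (R : realType) n (f : 'rV[R]_n -> R) x w :
  differentiable f x -> dot (grad f x) w = 'd f x w.
Proof.
move=> df; rewrite /dot [in RHS](row_sum_delta w) linear_sum.
by apply: eq_bigr => i _; rewrite linearZ /= !mxE /partial deriveE // mulrC.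
Qed.

Lemma is_diff_coord (R : realType) n (i : 'I_n) (x : 'rV[R]_n) :
  is_diff x (fun y : 'rV[R]_n => y 0 i) (fun y => y 0 i).
Proof.
have dc := differentiable_coord (R:=R) x 0 i.
apply: DiffDef => //; apply/funext => w; rewrite -deriveE //.
have -> : 'D_w (fun y : 'rV[R]_n => y 0 i) x = ('D_w (@id 'rV[R]_n) x) 0 i.
  by rewrite derive_mx ?mxE.
by rewrite derive_id.
Qed.

Lemma continuous_coord (R : realType) n (i : 'I_n) (x : 'rV[R]_n) :
  {for x, continuous (fun y : 'rV[R]_n => y 0 i)}.
Proof. by apply: differentiable_continuous; case: (is_diff_coord i x). Qed.

Lemma norm_coord_le (R : realType) n (h : 'rV[R]_n) i : `|h 0 i| <= `|h|.
Proof. by rewrite [leRHS]/Num.Def.normr/= mx_normrE; exact: (le_bigmax _ _ (0, i)). Qed.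

Lemma mulmxr_bound (R : realType) n (M : 'M[R]_n) :
  exists2 C : R, 0 < C & forall h : 'rV[R]_n, `|h *m M| <= C * `|h|.
Proof.
exists (1 + \sum_i `|row i M|); first by rewrite ltr_pwDl // sumr_ge0.
move=> h; rewrite mulmx_sum_row (le_trans (ler_norm_sum _ _ _)) //.
rewrite mulrDl mulr_suml (@le_trans _ _ (\sum_i `|row i M| * `|h|)) ?lerDr ?mul1r //.
apply: ler_sum => i _; rewrite normrZ mulrC ler_wpM2l //; exact: norm_coord_le.
Qed.

(** * Differentiability of inverse maps *)

(** Put h = g (k + f x) - x, which tends to 0 with k since g is continuous at
    f x. The expansion of f at x gives k = 'd f x h + o(h), so that
    L k = h + o(h). Hence h = O(k), and then h = L k + o(k). *)
Lemma differentiable_inverse (R : realType) (V W : normedModType R)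
    (f : V -> W) (g : W -> V) (x : V) (L : {linear W -> V}) :
  differentiable f x -> continuous L -> (forall w, L ('d f x w) = w) ->
  g (f x) = x -> {for f x, continuous g} -> (\forall y \near f x, f (g y) = y) ->
  differentiable g (f x).
Proof.
move=> df Lc Linv gfx gc fgE.
have [C C0 hC] := linear_lipschitz Lc.
have E : g \o shift (f x) = cst (g (f x)) + L +o_ 0 id.
  apply/eqaddoP => _ /posnumP[eps]; rewrite gfx.
  (* With C a Lipschitz constant of L, an error d |h| in the expansion of f costs
     C d |h|. The first bound on d absorbs half of |h|, whence |h| <= 2 C |k|;
     the second turns C d |h| into eps |k|. *)
  pose d := Num.min (2 * C)^-1 (eps%:num / (2 * C * C)).
  have d0 : 0 < d by rewrite lt_min invr_gt0 divr_gt0 ?mulr_gt0.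
  have dC1 : C * d <= 2^-1.
    apply: (@le_trans _ _ (C * (2 * C)^-1)).
      by apply: ler_wpM2l; [exact: ltW|rewrite ge_min lexx].
    by rewrite invfM mulrCA mulfV ?gt_eqF // mulr1.
  have dC2 : C * d * (2 * C) <= eps%:num.
    apply: (@le_trans _ _ (C * (eps%:num / (2 * C * C)) * (2 * C))).
      apply: ler_wpM2r; first by rewrite mulr_ge0 // ltW.
      by apply: ler_wpM2l; [exact: ltW|rewrite ge_min lexx orbT].
    by rewrite le_eqVlt; apply/orP; left; apply/eqP; field; rewrite gt_eqF.
  have fo : \forall h \near (0 : V), `|f (h + x) - f x - 'd f x h| <= d * `|h|.
    have /diff_locally/eqaddoP/(_ _ d0) := df.
    apply: filterS => h; rewrite /= -[X in `|X| <= _ -> _]/(f (h + x) - (f x + 'd f x h)).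
    by rewrite opprD addrA.
  have gk : (fun k => g (k + f x) - x) @ (0 : W) --> (0 : V).
    rewrite -[X in _ --> X](subrr x); apply: cvgB; last exact: cvg_cst.
    rewrite -[X in _ --> X]gfx; apply: (@cvg_comp _ _ _ (fun k => k + f x) g _ (nbhs (f x))) => //.
    have -> : nbhs (f x) = nbhs (0 + f x) by rewrite add0r.
    by apply: cvgD; [exact: cvg_id|exact: cvg_cst].
  have fg0 : \forall k \near (0 : W), f (g (k + f x)) = k + f x.
    move: fgE; rewrite (near_shift 0) subr0.
    by apply: filterS => k /=.
  near=> k; rewrite /= -[X in `|X| <= _]/(g (k + f x) - (x + L k)).
  have h1 : `|k - 'd f x (g (k + f x) - x)| <= d * `|g (k + f x) - x|.
    have : `|f (g (k + f x) - x + x) - f x - 'd f x (g (k + f x) - x)| <=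
       d * `|g (k + f x) - x| by near: k; exact: (gk _ fo).
    rewrite subrK (_ : f (g (k + f x)) = k + f x) ?addrK //.
    by near: k.
  set h := g (k + f x) - x in h1 *.
  have h2 := hC (k - 'd f x h).
  have Lr : L (k - 'd f x h) = L k - h by rewrite linearB Linv.
  have -> : g (k + f x) - (x + L k) = - L (k - 'd f x h).
    by rewrite Lr opprB /h opprD addrA.
  rewrite normrN.
  have h3 : `|h| <= `|L k| + `|L (k - 'd f x h)|.
    by rewrite Lr -[X in `|X| <= _](subKr (L k)) ler_normB.
  have h4 := hC k; have hn := normr_ge0 h; have kn := normr_ge0 k.
  have h5 : C * `|k - 'd f x h| <= C * d * `|h| by rewrite -mulrA ler_pM2l.
  have h6 : C * d * `|h| <= 2^-1 * `|h| by rewrite ler_wpM2r.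
  have h7 : `|h| <= 2 * C * `|k| by lra.
  rewrite (le_trans h2) // (le_trans h5) //.
  rewrite (@le_trans _ _ (C * d * (2 * C * `|k|))) //.
    by rewrite ler_wpM2l // mulr_ge0 // ltW.
  by rewrite mulrA ler_wpM2r.
by apply/diff_locallyP; rewrite (diff_unique Lc E).
Unshelve. all: by end_near. Qed.

Lemma diff_left_inverse (R : realType) n (f : 'rV[R]_n -> 'rV[R]_n) x :
  (forall w, 'd f x w = 0 -> w = 0) ->
  exists L : {linear 'rV[R]_n -> 'rV[R]_n},
    continuous L /\ forall w, L ('d f x w) = w.
Proof.
move=> dinj; pose J := 'J f x; have JE w : 'd f x w = w *m J by rewrite mul_rV_lin1.
have Ju : J \in unitmx.
  rewrite -row_free_unit -kermx_eq0; apply/eqP/row_matrixP => i.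
  by rewrite row0; apply: dinj; rewrite JE -row_mul mulmx_ker row0.
have [C C0 hC] := mulmxr_bound (invmx J).
exists (mulmxr (invmx J)); split; last by move=> w /=; rewrite JE mulmxK.
apply: bounded_linear_continuous; apply/linear_boundedP.
exists C; split; first exact: gtr0_real.
by move=> B CB w; rewrite (le_trans (hC w)) // ler_wpM2r // ltW.
Qed.

(** * Solving an equation along a direction of increase *)

Lemma is_diff_line (R : realType) (V : normedModType R) (x v : V) (t : R) :
  is_diff t (fun s : R => x + s *: v) (fun s => s *: v).
Proof.
have := is_diffD (is_diff_cst x t) (is_diff_scalel t v).
by rewrite add0r.
Qed.

Lemma is_derive_along (R : realType) (V : normedModType R) (F : V -> R) (x v : V) (t : R) :
  differentiable F (x + t *: v) ->
  is_derive t 1 (fun s : R => F (x + s *: v)) ('D_v F (x + t *: v)).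
Proof.
move=> dF; have hl := is_diff_line x v t.
have hd : is_diff (x + t *: v) F ('d F (x + t *: v)) by exact: differentiableP.
have [dc dcE] := is_diff_comp hl hd.
apply: DeriveDef; first exact/derivable1_diffP.
by rewrite !deriveE // dcE /= scale1r.
Qed.

Lemma ball_convex_along (R : realType) (V : normedModType R) (x0 x v : V) (r s t : R) :
  ball x0 r x -> ball x0 r (x + s *: v) -> 0 <= t <= s -> ball x0 r (x + t *: v).
Proof.
rewrite -ball_normE /= => hx hs /andP[t0 ts].
have [s0|s0] := eqVneq s 0; first by have -> : t = s by apply/le_anti; rewrite ts s0.
have sp : 0 < s by rewrite lt_def s0 (le_trans t0).
set c := t / s; have c0 : 0 <= c by rewrite divr_ge0 // ltW.
have c1 : c <= 1 by rewrite ler_pdivrMr // mul1r.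
have -> : x0 - (x + t *: v) = (1 - c) *: (x0 - x) + c *: (x0 - (x + s *: v)).
  have E y : x0 - (x + y) = (x0 - x) - y by rewrite opprD addrA.
  by rewrite !E [c *: _]scalerBr addrA -scalerDl subrK scale1r scalerA divfK.
have c1' : 0 <= 1 - c by rewrite subr_ge0.
clearbody c.
rewrite (le_lt_trans (ler_normD _ _)) // !normrZ (ger0_norm c0) (ger0_norm c1').
have -> : r = (1 - c) * r + c * r by ring.
have [c00|cn0] := eqVneq c 0; first by rewrite c00 subr0 !mul1r !mul0r !addr0.
apply: ler_ltD; first by rewrite ler_wpM2l // ltW.
by rewrite ltr_pM2l // lt_def cn0.
Qed.

Lemma lt_along (R : realType) (V : normedModType R) (v : V) (F : V -> R) x0 r x s :
  (forall y, ball x0 r y -> differentiable F y /\ 0 < 'D_v F y) ->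
  ball x0 r x -> ball x0 r (x + s *: v) -> 0 < s ->
  F x < F (x + s *: v).
Proof.
move=> hF hx hs s0.
pose u t := F (x + t *: v).
have ht t : 0 <= t <= s -> is_derive t 1 u ('D_v F (x + t *: v)).
  by move=> hts; apply: is_derive_along; apply: (hF _ _).1; exact: ball_convex_along hts.
have [c cs E] : exists2 c, c \in `]0, s[%R & u s - u 0 = 'D_v F (x + c *: v) * (s - 0).
  apply: (@MVT _ u (fun t => 'D_v F (x + t *: v))) => //.
    by move=> t; rewrite in_itv /= => /andP[t0 t1]; apply: ht; rewrite !ltW.
  apply: derivable_within_continuous => t; rewrite in_itv /= => hts.
  by have [] := ht t hts.
rewrite -subr_gt0; move: E; rewrite /u scale0r addr0 => ->.
move: cs; rewrite in_itv /= => /andP[c0 c1]; rewrite subr0 mulr_gt0 //.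
by apply: (hF _ _).2; apply: ball_convex_along hx hs _; rewrite !ltW.
Qed.

(** Existence part of the implicit function theorem, along the direction v. By
    monotonicity F takes values on both sides of F x0 at x0 + d v and x0 - d v;
    by continuity this persists when x0 is replaced by a nearby z and F x0 by a
    nearby b, and the intermediate value theorem applies between z - d v and
    z + d v. *)
Lemma solve_along (R : realType) (V : normedModType R) (v : V) (F : V -> R) x0 (W : set V) :
  nbhs x0 W -> (\forall y \near x0, differentiable F y /\ 0 < 'D_v F y) ->
  \forall z \near x0 & b \near F x0,
    exists2 s, W (z + s *: v) & F (z + s *: v) = b.
Proof.
move=> hW hF.
have /nbhs_ballP[r /= r0 hr] :
    nbhs x0 (W `&` [set y | differentiable F y /\ 0 < 'D_v F y]) by exact: filterI.
have {}hF y : ball x0 r y -> differentiable F y /\ 0 < 'D_v F y by move=> /hr[].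
have {hr}hW y : ball x0 r y -> W y by move=> /hr[].
(* The added 1 only serves to divide by a positive number when v = 0. *)
pose d := r / 2 / (`|v| + 1).
have vp : 0 < `|v| + 1 by rewrite ltr_wpDl.
have d0 : 0 < d by rewrite !divr_gt0.
have hd s z : `|s| <= d -> `|x0 - z| < r / 2 -> ball x0 r (z + s *: v).
  move=> sd hz; rewrite -ball_normE /= opprD addrA (le_lt_trans (ler_normB _ _)) //.
  rewrite normrZ (splitr r) ltr_leD // (@le_trans _ _ (d * `|v|)) //.
    by rewrite ler_wpM2r.
  by rewrite /d mulrAC ler_pdivrMr // ler_wpM2l ?lerDl // divr_ge0 // ltW.
have r2 : 0 < r / 2 by rewrite divr_gt0.
have x00 : `|x0 - x0| < r / 2 by rewrite subrr normr0.
have Bp : ball x0 r (x0 + d *: v) by apply: hd => //; rewrite gtr0_norm.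
have Bm : ball x0 r (x0 + (- d) *: v) by apply: hd => //; rewrite normrN gtr0_norm.
have B0 : ball x0 r x0 by exact: ballxx.
have up : F x0 < F (x0 + d *: v) by exact: lt_along Bp d0.
have dn : F (x0 + (- d) *: v) < F x0.
  have E : x0 = x0 + - d *: v + d *: v by rewrite scaleNr subrK.
  by rewrite [X in _ < F X]E; apply: (lt_along hF) => //; rewrite -E.
have cF s : ball x0 r (x0 + s *: v) -> (fun z => F (z + s *: v)) @ x0 --> F (x0 + s *: v).
  move=> /hF[/differentiable_continuous cF _].
  apply: (@cvg_comp _ _ _ (fun z => z + s *: v) F _ (nbhs (x0 + s *: v))) => //.
  by apply: cvgD; [exact: cvg_id|exact: cvg_cst].
pose mu := (F x0 + F (x0 + d *: v)) / 2; pose ml := (F x0 + F (x0 + (- d) *: v)) / 2.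
have n1 : \forall z \near x0, mu < F (z + d *: v).
  by move/cvgr_gt : (cF _ Bp); apply; rewrite /mu; lra.
have n2 : \forall z \near x0, F (z + (- d) *: v) < ml.
  by move/cvgr_lt : (cF _ Bm); apply; rewrite /ml; lra.
have n3 : \forall b \near F x0, b < mu by apply: lt_nbhsl; rewrite /mu; lra.
have n4 : \forall b \near F x0, ml < b by apply: lt_nbhsr; rewrite /ml; lra.
have n5 : \forall z \near x0, `|x0 - z| < r / 2.
  by apply/nbhs_ballP; exists (r / 2) => // z; rewrite -ball_normE.
near=> z b.
have hz : `|x0 - z| < r / 2 by near: z.
have b1 : b < F (z + d *: v) by apply: (@lt_trans _ _ mu); [near: b|near: z].
have b2 : F (z + (- d) *: v) < b by apply: (@lt_trans _ _ ml); [near: z|near: b].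
have [] := @IVT _ (fun s => F (z + s *: v)) (- d) d b.
- by rewrite ge0_cp // ltW.
- apply: derivable_within_continuous => t; rewrite in_itv /= -ler_norml => htd.
  by have [] := is_derive_along (hF _ (hd _ _ htd hz)).1.
- by rewrite ge_min le_max (ltW b1) (ltW b2) orbT.
move=> s; rewrite in_itv /= -ler_norml => hs Fs; exists s => //.
by apply: hW; exact: hd.
Unshelve. all: by end_near. Qed.

(** * Charts *)

Lemma near_eq_continuous (R : realType) (V W : normedModType R) (f g : V -> W) x :
  (\forall y \near x, f y = g y) -> {for x, continuous f} -> {for x, continuous g}.
Proof.
move=> fg; rewrite /prop_for /continuous_at -(nbhs_singleton fg); apply: cvg_trans.
exact: near_eq_cvg.
Qed.

Lemma diff_compE (R : realType) (U V W : normedModType R) (f : U -> V) (g : V -> W) x w :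
  differentiable f x -> differentiable g (f x) ->
  'd g (f x) ('d f x w) = 'D_w (g \o f) x.
Proof.
move=> df dg; have dgf := differentiable_comp df dg.
by rewrite (deriveE w dgf) (diff_comp df dg).
Qed.

(** Openness of f is a field because for the maps below it comes from the
    intermediate value theorem; the continuous left inverse of the differential
    is the form of its injectivity that [differentiable_inverse] uses. *)
Record chart (R : realType) (V W : normedModType R) (f : V -> W) (A : set V) : Prop :=
  Chart {
  chart_domain_open : open A ;
  chart_inj : {in A &, injective f} ;
  chart_open_map : forall x N, A x -> nbhs x N -> nbhs (f x) (f @` N) ;
  chart_differentiable : forall x, A x -> differentiable f x ;
  chart_diff_inv : forall x, A x -> exists L : {linear W -> V},
    continuous L /\ forall w, L ('d f x w) = w }.

Section ChartInverse.
Context {R : realType} {V W : normedModType R} (f : V -> W) (A : set V).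
Hypothesis hf : chart f A.
Local Notation g := ('pinv_(fun=> 0) A f).

Lemma chart_domain_nbhs x : A x -> nbhs x A.
Proof. by move=> Ax; apply: open_nbhs_nbhs; split=> //; exact: chart_domain_open hf. Qed.

Lemma chartK x : A x -> g (f x) = x.
Proof. by move=> Ax; rewrite pinvKV ?inE //; exact: chart_inj hf. Qed.

Lemma chart_image_pinv y : (f @` A) y -> A (g y) /\ f (g y) = y.
Proof. by case=> x Ax <-; rewrite chartK. Qed.

Lemma chart_image_nbhs x : A x -> nbhs (f x) (f @` A).
Proof.
by move=> Ax; apply: (chart_open_map hf) => //; exact: chart_domain_nbhs.
Qed.

Lemma chart_pinv_continuous x : A x -> {for f x, continuous g}.
Proof.
move=> Ax N; rewrite /= chartK // => hN.
have hNA : nbhs x (N `&` A).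
  by apply: filterI => //; exact: chart_domain_nbhs.
apply: filterS (chart_open_map hf Ax hNA) => _ [z [Nz Az] <-] /=.
by rewrite chartK.
Qed.

Lemma chart_pinv_differentiable x : A x -> differentiable g (f x).
Proof.
move=> Ax; have [L [Lc hL]] := chart_diff_inv hf Ax.
apply: (differentiable_inverse (L := L)) => //.
- exact: chart_differentiable hf _ _.
- exact: chartK.
- exact: chart_pinv_continuous.
- by apply: filterS (chart_image_nbhs Ax) => y /chart_image_pinv[].
Qed.

Lemma diff_chart_pinv x k : A x -> 'd f x ('d g (f x) k) = k.
Proof.
move=> Ax; have dg := chart_pinv_differentiable Ax.
have df : differentiable f (g (f x)) by rewrite chartK //; exact: chart_differentiable hf _ _.
have := diff_compE k dg df; rewrite chartK // => ->.
rewrite (near_eq_derive (g := id)) ?derive_id //.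
by apply: filterS (chart_image_nbhs Ax) => y /chart_image_pinv[].
Qed.

End ChartInverse.

(** * Two triangular charts *)

Lemma diff_partial (R : realType) (F : 'rV[R]_2 -> R) x w : differentiable F x ->
  'd F x w = w 0 0 * partial 0 F x + w 0 1 * partial 1 F x.
Proof. by move=> dF; rewrite linear_row2 /partial !deriveE. Qed.

Lemma row2_chart_diff_inv (R : realType) (f : 'rV[R]_2 -> 'rV[R]_2) x (l : 'rV[R]_2 -> 'rV[R]_2) :
  is_diff x f l -> (forall w, l w 0 0 = 0 -> l w 0 1 = 0 -> w = 0) ->
  exists L : {linear 'rV[R]_2 -> 'rV[R]_2},
    continuous L /\ forall w, L ('d f x w) = w.
Proof.
case=> df dfE hl; apply: diff_left_inverse => w; rewrite dfE => lw.
by apply: hl; rewrite lw mxE.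
Qed.

(** This chart maps the level sets of F to lines on which the first coordinate is
    constant; it provides the implicit function theorem for the equation
    F x = c solved for the first coordinate. *)
Lemma chart_level (R : realType) (F : 'rV[R]_2 -> R) (x0 : 'rV[R]_2) r :
  (forall y, ball x0 r y -> differentiable F y /\ 0 < partial 0 F y) ->
  chart (fun x => row2 (F x) (x 0 1)) (ball x0 r).
Proof.
move=> hF.
have dPsi x : ball x0 r x ->
    is_diff x (fun x => row2 (F x) (x 0 1)) (fun w => row2 ('d F x w) (w 0 1)).
  move=> /hF[dF _]; apply: is_diff_row2; first exact: differentiableP.
  exact: is_diff_coord.
have lt_inj x y : ball x0 r x -> ball x0 r y -> F x = F y -> x 0 1 = y 0 1 -> ~ x 0 0 < y 0 0.
  move=> Bx By Fxy xy1 xy0.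
  have yE : y = x + (y 0 0 - x 0 0) *: delta_mx 0 0.
    by apply: rV2P; rewrite !mxE /= ?xy1; ring.
  have : F x < F (x + (y 0 0 - x 0 0) *: delta_mx 0 0).
    by apply: (lt_along hF) => //; [rewrite -yE|rewrite subr_gt0].
  by rewrite -yE Fxy ltxx.
split.
- exact: ball_open.
- move=> x y; rewrite !inE => Bx By /rowP E.
  have := E 0; have := E 1; rewrite !row2E0 !row2E1 => E1 E0.
  apply: rV2P => //; apply/eqP; rewrite eq_le !leNgt; apply/andP; split; apply/negP.
    exact: lt_inj.
  exact: lt_inj.
- move=> x N Bx hN.
  (* To hit y near the image of x, move along the first coordinate from the
     point with first coordinate x 0 0 and second coordinate y 0 1. *)
  have hn : \forall y \near x, differentiable F y /\ 0 < partial 0 F y.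
    by apply: (filterS hF); apply: open_nbhs_nbhs; split=> //; exact: ball_open.
  have hs := solve_along hN hn.
  pose y0 := row2 (F x) (x 0 1).
  have c0 : {for y0, continuous (fun y : 'rV[R]_2 => y 0 0)} := @continuous_coord _ _ _ _.
  have c1 : {for y0, continuous (fun y : 'rV[R]_2 => row2 (x 0 0) (y 0 1))}.
    apply: continuous_row2; last exact: continuous_coord.
    exact/differentiable_continuous/differentiable_cst.
  rewrite /prop_for /continuous_at /y0 row2E1 row2_eta in c1.
  rewrite /prop_for /continuous_at /y0 row2E0 in c0.
  apply: (@filterS _ (nbhs y0) (nbhs_filter y0) _ _ _ (cvg_pair c1 c0 hs)) => y /= [s Ns Fs].
  exists (row2 (x 0 0) (y 0 1) + s *: delta_mx 0 0) => //.
  by rewrite Fs; apply: rV2P; rewrite !mxE //= mulr0 addr0.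
- by move=> x Bx; case: (dPsi x Bx).
- move=> x Bx; apply: (row2_chart_diff_inv (dPsi x Bx)) => w.
  have [dF Fp] := hF x Bx; rewrite row2E0 row2E1 diff_partial // => + w1.
  rewrite w1 mul0r addr0 => /eqP; rewrite mulf_eq0 (gt_eqF Fp) orbF => /eqP w0.
  by apply: rV2P; rewrite mxE.
Qed.

Section Regime.
Context {R : realType} (sigma_min : R) (e : 'rV[R]_2 -> R) (S : set 'rV[R]_2).
Hypothesis hS : admissible_regime sigma_min e S.

Lemma regime_nbhs x : S x -> nbhs x S.
Proof. by move=> Sx; apply: open_nbhs_nbhs; split=> //; exact: regime_open hS. Qed.

Lemma regime_volume_gt0 x : S x -> 0 < x 0 0.
Proof. by move=> /(regime_sub hS)/interior_subset[]. Qed.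

Lemma regime_differentiable x : S x -> differentiable e x.
Proof. by move=> Sx; case: ((regime_C2 hS).1 x Sx). Qed.

Lemma regime_partial_differentiable i x : S x -> differentiable (partial i e) x.
Proof. by move=> Sx; case: ((regime_C2 hS).2 i x Sx). Qed.

Lemma is_diff_Phi x : S x ->
  is_diff x (Phi e) (fun w => row2 (- (x 0 0) ^- 2 * w 0 0)
    (e x * (- (x 0 0) ^- 2 * w 0 0) + (x 0 0)^-1 * 'd e x w)).
Proof.
move=> Sx; have x0 := gt_eqF (regime_volume_gt0 Sx).
have [dc dcE] := is_diff_coord (0 : 'I_2) x.
have hV : is_diff x (fun y : 'rV[R]_2 => (y 0 0)^-1) (fun w => - (x 0 0) ^- 2 * w 0 0).
  apply: DiffDef; first by apply: differentiableV => //; rewrite x0.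
  by rewrite diffV ?x0 // dcE.
have he : is_diff x e ('d e x) by apply: differentiableP; exact: regime_differentiable.
by apply: is_diff_row2 => //; exact: (is_diffM he hV).
Qed.

(** The positive temperature makes e increase along the entropy axis, which
    gives openness and, together with 1 / nu having nonzero derivative, an
    injective differential. *)
Lemma chart_Phi : chart (Phi e) S.
Proof.
split.
- exact: regime_open hS.
- move=> x y; rewrite !inE => Sx Sy /rowP E.
  have := E 0; have := E 1; rewrite !row2E0 !row2E1 => E1 /invr_inj E0.
  have xn0 : (x 0 0)^-1 != 0 by rewrite invr_eq0 gt_eqF // regime_volume_gt0.
  apply: rV2P => //; apply: (regime_inj hS (nu := x 0 0)).
  + by rewrite row2_eta.
  + by rewrite E0 row2_eta.
  + by rewrite row2_eta [in RHS]E0 row2_eta; apply: (mulIf xn0); rewrite E1 E0.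
- move=> x N Sx hN.
  have x0 := regime_volume_gt0 Sx.
  have hn : \forall y \near x, differentiable e y /\ 0 < 'D_(delta_mx 0 1) e y.
    apply: filterS (regime_nbhs Sx) => y Sy; split; first exact: regime_differentiable.
    exact: regime_temperature_gt0 hS _ Sy.
  have hs := solve_along hN hn.
  (* A preimage of y near Phi e x has volume 1 / y 0 0, and its entropy solves
     e = y 0 1 / y 0 0. *)
  set y0 := Phi e x.
  have dc i : differentiable (fun y : 'rV[R]_2 => y 0 i) y0 by exact: differentiable_coord.
  have y00 : y0 0 0 = (x 0 0)^-1 by rewrite row2E0.
  have y0n : y0 0 0 != 0 by rewrite y00 invr_eq0 gt_eqF.
  have dV : differentiable (fun y : 'rV[R]_2 => (y 0 0)^-1) y0 by exact: differentiableV.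
  have c0 : {for y0, continuous (fun y : 'rV[R]_2 => y 0 1 * (y 0 0)^-1)}.
    exact/differentiable_continuous/(differentiableM (dc 1) dV).
  have c1 : {for y0, continuous (fun y : 'rV[R]_2 => row2 (y 0 0)^-1 (x 0 1))}.
    apply: continuous_row2; first exact: differentiable_continuous.
    exact/differentiable_continuous/differentiable_cst.
  have cp : {for y0, continuous (fun y : 'rV[R]_2 => y 0 0)} := @continuous_coord _ _ _ _.
  have yp : \forall y \near y0, 0 < (y : 'rV[R]_2) 0 0.
    by move/cvgr_gt : cp; apply; rewrite y00 invr_gt0.
  rewrite /prop_for /continuous_at y00 invrK row2_eta in c1.
  rewrite /prop_for /continuous_at y00 invrK row2E1 divfK ?gt_eqF // in c0.
  have hh : \forall y \near y0, exists2 s,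
      N (row2 ((y : 'rV[R]_2) 0 0)^-1 (x 0 1) + s *: delta_mx 0 1) &
      e (row2 ((y : 'rV[R]_2) 0 0)^-1 (x 0 1) + s *: delta_mx 0 1) = y 0 1 / y 0 0.
    exact: (cvg_pair c1 c0 hs).
  move: yp hh; apply: filterS2 => y y0p [s Ns es].
  exists (row2 (y 0 0)^-1 (x 0 1) + s *: delta_mx 0 1) => //.
  have yn := gt_eqF y0p.
  rewrite /Phi es; apply: rV2P; rewrite !mxE /= mulr0 addr0 invrK //.
  by rewrite divfK // yn.
- by move=> x Sx; case: (is_diff_Phi Sx).
- move=> x Sx; apply: (row2_chart_diff_inv (is_diff_Phi Sx)) => w.
  have x0 := gt_eqF (regime_volume_gt0 Sx).
  rewrite row2E0 row2E1 => /eqP; rewrite mulf_eq0 oppr_eq0 invr_eq0 expf_eq0 x0 /= => /eqP w0.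
  rewrite w0 !mulr0 add0r diff_partial; last exact: regime_differentiable.
  rewrite w0 mul0r add0r => /eqP; rewrite !mulf_eq0 invr_eq0 x0 /=.
  rewrite (gt_eqF (regime_temperature_gt0 hS Sx)) orbF => /eqP w1.
  by apply: rV2P; rewrite mxE.
Qed.

(** * Pressure and tangent spaces of isobars *)

Local Notation p := (pressure e S).
Local Notation Gamma P := (isobar e S P).

Lemma pressure_Phi x : S x -> p (Phi e x) = phat e x.
Proof. by move=> Sx; rewrite /pressure (chartK chart_Phi). Qed.

Lemma regime_phat_differentiable x : S x -> differentiable (phat e) x.
Proof. by move=> Sx; apply: differentiableN; exact: regime_partial_differentiable. Qed.

Lemma pressure_differentiable tau : S_tau e S tau -> differentiable p tau.
Proof.
case=> x Sx <-; apply: differentiable_comp.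
  exact: (chart_pinv_differentiable chart_Phi).
by rewrite (chartK chart_Phi) //; exact: regime_phat_differentiable.
Qed.

(** Since p \o Phi e = - e_nu, the differential of p takes the value - e_nunu
    at the image of the first basis vector under the differential of Phi. *)
Lemma diff_pressure_neq0 tau : S_tau e S tau -> exists k, 'd p tau k != 0.
Proof.
case=> x Sx <-; exists ('d (Phi e) x (delta_mx 0 0)).
have dPhi := chart_differentiable chart_Phi Sx.
have dp : differentiable p (Phi e x) by apply: pressure_differentiable; exists x.
rewrite diff_compE //.
rewrite (near_eq_derive (g := phat e)); last first.
  by apply: filterS (regime_nbhs Sx) => y Sy /=; rewrite pressure_Phi.
rewrite deriveN; last exact/diff_derivable/regime_partial_differentiable.
by rewrite oppr_eq0 gt_eqF //; exact: regime_nunu_gt0 hS _ Sx.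
Qed.

(** The pressure is constant along every parameterization of the isobar. *)
Lemma tangent_space_sub_ker P tau w : Gamma P tau ->
  tangent_space (Gamma P) tau w -> 'd p tau w = 0.
Proof.
move=> [St _] [I [phi [t [c [hphi It phit ->]]]]].
rewrite linearZ /= -phit; apply/eqP; rewrite scaler_eq0; apply/orP; right; apply/eqP.
have dphi : differentiable phi t by apply/derivable1_diffP; exact: param_derivable hphi _ _.
have dp : differentiable p (phi t) by rewrite phit; exact: pressure_differentiable.
rewrite deriveE // diff_compE //.
rewrite (near_eq_derive (g := cst P)) ?derive_cst //.
have : nbhs t I by apply: open_nbhs_nbhs; split => //; exact: param_open hphi.
by apply: filterS => s Is /=; case: (param_sub hphi (ex_intro2 _ _ s Is erefl)).
Qed.

(** With a = nu, E = e, p_i the first partial derivatives of e and f_i those of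
    e_nu, the function below is the image under the differential of Phi of the
    vector (k, 1) tangent to the curve e_nu = - P. *)
Lemma continuous_isobar_velocity (V : normedModType R) (a E p0 p1 f0 f1 : V -> R) x :
  {for x, continuous a} -> {for x, continuous E} ->
  {for x, continuous p0} -> {for x, continuous p1} ->
  {for x, continuous f0} -> {for x, continuous f1} -> a x != 0 -> f0 x != 0 ->
  {for x, continuous (fun y => let k := - f1 y / f0 y in
     row2 (- (a y) ^- 2 * k) (E y * (- (a y) ^- 2 * k) + (a y)^-1 * (k * p0 y + 1 * p1 y)))}.
Proof.
move=> ca cE cp0 cp1 cf0 cf1 a0 f00.
have ck : {for x, continuous (fun y => - f1 y / f0 y)}.
  by apply: cvgM; [exact: cvgN|exact: cvgV].
have cv : {for x, continuous (fun y => (a y)^-1)} by exact: cvgV.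
have c2 : {for x, continuous (fun y => - (a y) ^- 2 * (- f1 y / f0 y))}.
  apply: cvgM => //; apply: cvgN; apply: cvgV; first by rewrite expf_neq0.
  exact: cvgM.
apply: continuous_row2 => //; apply: cvgD; first exact: cvgM.
apply: cvgM => //; apply: cvgD; first exact: cvgM.
by apply: cvgM => //; exact: cvg_cst.
Qed.

(** In the (nu, sigma) plane the isobar is the level set e_nu = - P, which is
    locally a graph over the entropy because e_nunu > 0. Its points are
    parameterized by their entropy, and then mapped by Phi. *)
Lemma isobar_parameterization P tau : Gamma P tau ->
  exists (I : set R) phi t,
    [/\ local_parameterization (Gamma P) tau I phi, I t & phi t = tau].
Proof.
move=> [[x0 Sx0 <-]]; rewrite pressure_Phi // => hx0.
pose F := partial 0 e.
have Fx0 : F x0 = - P by rewrite -hx0 /phat opprK.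
have /nbhs_ballP[r /= r0 hr] := regime_nbhs Sx0.
set B := ball x0 r in hr.
have hF y : B y -> differentiable F y /\ 0 < partial 0 F y.
  move=> By; split; first by apply: regime_partial_differentiable; exact: hr.
  by apply: (regime_nunu_gt0 hS); exact: hr.
have hPsi : chart (fun x => row2 (F x) (x 0 1)) B := chart_level hF.
pose Psi x := row2 (F x) (x 0 1).
(* G s is the point of entropy s of the curve F = - P. *)
pose G s := 'pinv_(fun=> 0) B Psi (row2 (- P) s).
have dl s : is_diff s (fun s : R => row2 (- P) s) (fun h => row2 0 h).
  by apply: is_diff_row2; exact: is_diff_cst.
have Bx0 : B x0 by exact: ballxx.
have [d /= d0 hd] : exists2 d, 0 < d & ball (x0 0 1) d `<=` [set s | (Psi @` B) (row2 (- P) s)].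
  apply/nbhs_ballP; have := chart_image_nbhs hPsi Bx0.
  rewrite Fx0; have [dl0 _] := dl (x0 0 1).
  exact: (differentiable_continuous dl0).
pose I : set R := ball (x0 0 1) d.
have hG s : I s -> [/\ B (G s), F (G s) = - P & G s 0 1 = s].
  move=> /hd /(chart_image_pinv hPsi)[BG /rowP E]; split => //.
    by have := E 0; rewrite !row2E0.
  by have := E 1; rewrite !row2E1.
have PsiG s : I s -> row2 (- P) s = Psi (G s).
  by move=> /hG[_ F1 G1]; rewrite /Psi F1 G1.
have dG s : I s -> differentiable G s.
  move=> Is; have [dl0 _] := dl s; have [BG _ _] := hG s Is.
  apply: (differentiable_comp dl0); rewrite (PsiG _ Is).
  exact: (chart_pinv_differentiable hPsi BG).
(* The derivative of G, from F (G s) = - P and G s 0 1 = s. *)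
pose K x := row2 (- partial 1 F x / partial 0 F x) 1 : 'rV[R]_2.
have GK s : I s -> 'd G s 1 = K (G s).
  move=> Is; have [BG _ _] := hG s Is; have [dl0 dlE] := dl s.
  have [dF Fp] := hF _ BG.
  have dPi := chart_pinv_differentiable hPsi BG.
  have dPi' : differentiable ('pinv_(fun=> 0) B Psi) (row2 (- P) s).
    by rewrite (PsiG _ Is).
  rewrite -(deriveE _ (dG s Is)) -(diff_compE _ dl0 dPi') dlE (PsiG _ Is).
  set k := 'd _ _ _.
  have : 'd Psi (G s) k = row2 0 1 by exact: (diff_chart_pinv hPsi _ BG).
  have [_ dPsiE] : is_diff (G s) Psi (fun w => row2 ('d F (G s) w) (w 0 1)).
    by apply: is_diff_row2; [exact: differentiableP|exact: is_diff_coord].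
  rewrite dPsiE => /rowP E; have := E 0; have := E 1; rewrite !row2E0 !row2E1 => k1.
  rewrite diff_partial // k1 mul1r => /eqP; rewrite addr_eq0 => /eqP k0.
  apply: rV2P; rewrite ?row2E0 ?row2E1 //.
  by rewrite -k0 mulfK ?gt_eqF.
pose phi s := Phi e (G s).
have dphi s : I s -> differentiable phi s.
  move=> Is; have [/hr SG _ _] := hG s Is.
  by apply: differentiable_comp; [exact: dG|exact: chart_differentiable chart_Phi _ _].
have phiK s : I s -> 'D_1 phi s = 'd (Phi e) (G s) (K (G s)).
  move=> Is; have [/hr SG _ _] := hG s Is.
  by rewrite -GK // (diff_compE _ (dG s Is) (chart_differentiable chart_Phi SG)).
have Iopen : open I by exact: ball_open.
have phiGamma s : I s -> Gamma P (phi s).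
  move=> /hG[/hr SG FG _]; split; first by exists (G s).
  by rewrite pressure_Phi // /phat -/F FG opprK.
have GPsi x : B x -> F x = - P -> G (x 0 1) = x.
  by move=> Bx FE; rewrite /G -FE; exact: (chartK hPsi).
have It : I (x0 0 1) by exact: ballxx.
exists I, phi, (x0 0 1); split => //; last by rewrite /phi GPsi.
split=> //.
- by rewrite /I ball_itv; exact: interval_is_interval.
- by move=> _ [s Is <-]; exact: phiGamma.
- by move=> s Is; apply/derivable1_diffP; exact: dphi.
- move=> t Ht.
  pose M x := 'd (Phi e) x (K x).
  have [BG _ _] := hG t Ht.
  have [dF Fp] := hF _ BG.
  have SG := hr _ BG.
  have cM : {for G t, continuous M}.
    pose M' y := let k := - partial 1 F y / partial 0 F y in
      row2 (- (y 0 0) ^- 2 * k) (e y * (- (y 0 0) ^- 2 * k) +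
        (y 0 0)^-1 * (k * partial 0 e y + 1 * partial 1 e y)) : 'rV[R]_2.
    have MM y : S y -> M y = M' y.
      move=> Sy; have [_ E] := is_diff_Phi Sy.
      by rewrite /M E diff_partial ?row2E0 ?row2E1 //; exact: regime_differentiable.
    have cM' : {for G t, continuous M'}.
      have [C1e C2e] := regime_C2 hS.
      apply: continuous_isobar_velocity.
      + exact: continuous_coord.
      + exact/differentiable_continuous/regime_differentiable.
      + exact: (C1e _ SG).2.
      + exact: (C1e _ SG).2.
      + exact: (C2e 0 _ SG).2.
      + exact: (C2e 0 _ SG).2.
      + by rewrite gt_eqF // regime_volume_gt0.
      + by rewrite gt_eqF.
    have MMn : \forall y \near G t, M' y = M y.
      by apply: filterS (regime_nbhs SG) => y Sy; rewrite MM.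
    exact: near_eq_continuous MMn cM'.
  have cG : {for t, continuous G} by exact/differentiable_continuous/dG.
  have cMG : {for t, continuous (M \o G)} by exact: (continuous_comp cG cM).
  have phiKn : \forall s \near t, (M \o G) s = 'D_1 phi s.
    have : nbhs t I by apply: open_nbhs_nbhs; split.
    by apply: filterS => s Is; rewrite phiK.
  exact: near_eq_continuous phiKn cMG.
- move=> s Is; rewrite (phiK _ Is); apply/eqP => E.
  have [/hr SG _ _] := hG s Is.
  have [L [_ LK]] := chart_diff_inv chart_Phi SG.
  have := LK (K (G s)); rewrite E linear0 => /rowP/(_ 1); rewrite row2E1 mxE => /eqP.
  by rewrite eq_sym oner_eq0.
- have hW : nbhs x0 (B `&` [set x : 'rV[R]_2 | I (x 0 1)]).
    apply: filterI; first by apply/nbhs_ballP; exists r.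
    apply: (@continuous_coord _ _ 1 x0); apply: open_nbhs_nbhs; split => //.
  have := chart_pinv_continuous chart_Phi Sx0.
  rewrite /prop_for /continuous_at (chartK chart_Phi Sx0).
  move=> /(_ _ hW) hn.
  apply: (@filterS _ (nbhs (Phi e x0)) (nbhs_filter (Phi e x0)) _ _ _ hn) => y /= [By Iy] [Sy py].
  have [Sz zE] := chart_image_pinv chart_Phi Sy.
  exists ('pinv_(fun=> 0) S (Phi e) y 0 1) => //.
  rewrite /phi GPsi //.
  by rewrite -py /pressure /phat opprK.
Qed.

(** The kernel of the differential of p is a line, and it contains the nonzero
    velocity of a parameterization. *)
Lemma ker_sub_tangent_space P tau w : Gamma P tau ->
  'd p tau w = 0 -> tangent_space (Gamma P) tau w.
Proof.
move=> Gt dw; have [I [phi [t [hphi It phit]]]] := isobar_parameterization Gt.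
have u0 := param_regular hphi It.
have du : 'd p tau ('D_1 phi t) = 0.
  apply: (tangent_space_sub_ker Gt); exists I, phi, t, 1; split => //.
  by rewrite scale1r.
have [c ->] := ker_form_line (diff_pressure_neq0 Gt.1) u0 du dw.
by exists I, phi, t, c.
Qed.

Lemma tangent_spaceE P tau w : Gamma P tau ->
  tangent_space (Gamma P) tau w <-> 'd p tau w = 0.
Proof.
by move=> Gt; split; [exact: tangent_space_sub_ker|exact: ker_sub_tangent_space].
Qed.

End Regime.

(** * Reduced fluxes *)

Section Fluxes.
Context {R : realType}.
Implicit Types (U d : 'rV[R]_3) (tau : 'rV[R]_2) (P V : R).

Lemma row3E0 (a b c : R) : row3 a b c 0 0 = a. Proof. by rewrite mxE. Qed.

Lemma rV3P (u w : 'rV[R]_3) :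
  u 0 0 = w 0 0 -> u 0 1 = w 0 1 -> u 0 2 = w 0 2 -> u = w.
Proof.
move=> h0 h1 h2; apply/rowP => -[[|[|[|//]]] hi].
- by rewrite (_ : Ordinal hi = 0) //; apply/val_inj.
- by rewrite (_ : Ordinal hi = 1) //; apply/val_inj.
- by rewrite (_ : Ordinal hi = 2) //; apply/val_inj.
Qed.

Lemma is_diff_inv_coord n (i : 'I_n) (U : 'rV[R]_n) : U 0 i != 0 ->
  is_diff U (fun u : 'rV[R]_n => (u 0 i)^-1) (fun w => - (U 0 i) ^- 2 * w 0 i).
Proof.
move=> U0; have [dc dcE] := is_diff_coord i U.
by apply: DiffDef; [exact: differentiableV|rewrite diffV // dcE].
Qed.

Lemma dot_grad_velocity U d : U 0 0 != 0 ->
  dot (grad velocity U) d = (d 0 1 - velocity U * d 0 0) / U 0 0.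
Proof.
move=> U0; have [dv dvE] := is_diffM (@is_diff_coord R 3 1 U) (@is_diff_inv_coord 3 0 U U0).
rewrite (dot_grad d dv) dvE /velocity.
rewrite -[LHS]/(U 0 1 * (- (U 0 0) ^- 2 * d 0 0) + (U 0 0)^-1 * d 0 1).
by field.
Qed.

Lemma mulmx_jacobian_tau_of U d : U 0 0 != 0 ->
  d *m 'J tau_of U =
  row2 (d 0 0) (2^-1 * velocity U ^+ 2 * d 0 0 - velocity U * d 0 1 + d 0 2).
Proof.
move=> U0.
have h1 := is_diffM (@is_diff_coord R 3 1 U) (@is_diff_coord R 3 1 U).
have h2 := is_diffM h1 (@is_diff_inv_coord 3 0 U U0).
have h3 := is_diffB (@is_diff_coord R 3 2 U) (is_diffZ 2^-1 h2).
have [dt dtE] := is_diff_row2 (@is_diff_coord R 3 0 U) h3.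
(* tau_of, written with the pointwise operations on functions for which the
   rules of differentiation are stated. *)
have E : tau_of = (fun u : 'rV[R]_3 => row2 (u 0 0)
    (((fun u : 'rV[R]_3 => u 0 2) - 2^-1 *: ((fun u : 'rV[R]_3 => u 0 1) *
      (fun u : 'rV[R]_3 => u 0 1) * (fun u : 'rV[R]_3 => (u 0 0)^-1))) u)).
  by apply/funext => u; rewrite /tau_of expr2.
rewrite E -deriveEjacobian // deriveE // dtE /velocity.
apply: rV2P; rewrite ?row2E0 ?row2E1 //.
rewrite -[LHS]/(d 0 2 - 2^-1 * (U 0 1 * U 0 1 * (- (U 0 0) ^- 2 * d 0 0) +
  (U 0 0)^-1 * (U 0 1 * d 0 1 + U 0 1 * d 0 1))).
by field.
Qed.

(** The change of tau = (rho, eps) under the increment d of (rho, m, E) at a state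
    of velocity V, when d does not change the velocity, d 0 1 = V * d 0 0. *)
Definition reduced V d : 'rV[R]_2 := row2 (d 0 0) (d 0 2 - 2^-1 * V ^+ 2 * d 0 0).

Lemma reducedB V d1 d2 : reduced V (d1 - d2) = reduced V d1 - reduced V d2.
Proof. by apply: rV2P; rewrite !mxE //=; ring. Qed.

Lemma velocity_Theta tau V : tau 0 0 != 0 -> velocity (Theta tau V) = V.
Proof. by move=> t0; rewrite /velocity !mxE /=; field. Qed.

Lemma tau_of_Theta tau V : tau 0 0 != 0 -> tau_of (Theta tau V) = tau.
Proof. by move=> t0; apply: rV2P; rewrite !mxE //=; field. Qed.

Section FluxRegime.
Context (sigma_min : R) (e : 'rV[R]_2 -> R) (S : set 'rV[R]_2).
Hypothesis hS : admissible_regime sigma_min e S.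

Lemma S_tau_density_gt0 tau : S_tau e S tau -> 0 < tau 0 0.
Proof. by case=> x Sx <-; rewrite row2E0 invr_gt0 (regime_volume_gt0 hS). Qed.

Lemma S_U_tau U : S_U e S U -> S_tau e S (tau_of U) /\ 0 < U 0 0.
Proof.
case=> tau [v [St ->]]; have t0 := S_tau_density_gt0 St.
by rewrite tau_of_Theta ?gt_eqF // row3E0.
Qed.

Lemma Theta_equilibrium P V tau : isobar e S P tau ->
  equilibrium_states e S P V (Theta tau V).
Proof.
move=> [St pt]; have t0 := S_tau_density_gt0 St.
by split; rewrite ?tau_of_Theta ?velocity_Theta ?gt_eqF //; exists tau, V.
Qed.

Lemma equilibrium_isobar P V U : equilibrium_states e S P V U -> isobar e S P (tau_of U).
Proof. by case=> /S_U_tau[]. Qed.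

Lemma reduced_euler_flux P V U : equilibrium_states e S P V U ->
  reduced V (euler_flux e S U) = V *: (tau_of U + row2 0 P).
Proof.
case=> /S_U_tau[_ U0] pU vU; apply: rV2P; rewrite !mxE /= ?pU.
  by rewrite vU addr0 mulrC.
by rewrite -vU /velocity; field; rewrite gt_eqF.
Qed.

(** The velocity has differential (d 0 1 - V * d 0 0) / rho. Substituting
    d 0 1 = V * d 0 0 in the differential of tau_of turns the energy component
    V^2 d0 / 2 - V d1 + d2 into d2 - V^2 d0 / 2. *)
Lemma equilibrium_preserved_tangent P V U d : equilibrium_states e S P V U ->
  (dot (grad velocity U) d = 0 /\
   dot (grad (pressure e S) (tau_of U)) (d *m 'J tau_of U) = 0) <->
  (d 0 1 = V * d 0 0 /\
   tangent_space (isobar e S P) (tau_of U) (reduced V d)).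
Proof.
move=> hU; have hG := equilibrium_isobar hU.
case: (hU) => /S_U_tau[St U0] pU vU; have Un0 : U 0 0 != 0 by rewrite gt_eqF.
rewrite (tangent_spaceE hS) // dot_grad_velocity //.
rewrite (dot_grad _ (pressure_differentiable hS St)) mulmx_jacobian_tau_of // vU.
have E : d 0 1 = V * d 0 0 ->
    row2 (d 0 0) (2^-1 * V ^+ 2 * d 0 0 - V * d 0 1 + d 0 2) = reduced V d.
  by move=> ->; apply: rV2P; rewrite !mxE //=; field.
split=> -[h1 h2].
- have {}h1 : d 0 1 = V * d 0 0.
    move/eqP : h1; rewrite mulf_eq0 invr_eq0 (negPf Un0) orbF subr_eq0.
    by move/eqP.
  by rewrite -E.
- by rewrite E // h1 subrr mul0r.
Qed.

Lemma tangent_lineE P tau q : isobar e S P tau ->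
  tangent_line (isobar e S P) tau q <-> 'd (pressure e S) tau (q - tau) = 0.
Proof.
move=> hG; split.
- by case=> w /(tangent_spaceE hS _ hG) dw <-; rewrite addrAC subrr add0r.
- move=> /(tangent_spaceE hS _ hG) hq; exists (q - tau) => //.
  by rewrite addrC subrK.
Qed.

(** The common point is the reduced value of fh at the two states of velocity 1
    over tau1 and tau2, shifted by (0, P). *)
Lemma preserving_tangent_lines_meet fh P tau1 tau2 :
  consistent e S fh -> pressure_equilibrium_preserving e S fh -> 0 < P ->
  isobar e S P tau1 -> isobar e S P tau2 ->
  tangent_line (isobar e S P) tau1 `&` tangent_line (isobar e S P) tau2 !=set0.
Proof.
move=> hc hp P0 h1 h2.
have e1 := Theta_equilibrium 1 h1; have e2 := Theta_equilibrium 1 h2.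
set U1 := Theta tau1 1 in e1; set U2 := Theta tau2 1 in e2.
have t1 : tau_of U1 = tau1 by rewrite tau_of_Theta // gt_eqF // S_tau_density_gt0 //; case: h1.
have t2 : tau_of U2 = tau2 by rewrite tau_of_Theta // gt_eqF // S_tau_density_gt0 //; case: h2.
have [_ a1] := (equilibrium_preserved_tangent _ e1).1 (hp _ _ P0 _ _ _ e1 e1 e2).
have [_ a2] := (equilibrium_preserved_tangent _ e2).1 (hp _ _ P0 _ _ _ e1 e2 e2).
move/(tangent_spaceE hS _ (equilibrium_isobar e1)) : a1.
move/(tangent_spaceE hS _ (equilibrium_isobar e2)) : a2.
have [s1 _ _] := e1; have [s2 _ _] := e2.
rewrite /flux_difference !reducedB (hc _ s1) (hc _ s2).
rewrite (reduced_euler_flux e1) (reduced_euler_flux e2) t1 t2 !scale1r => a2 a1.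
exists (reduced 1 (fh U1 U2) - row2 0 P); split; apply/tangent_lineE => //.
- apply/eqP; rewrite -oppr_eq0 -linearN; apply/eqP; rewrite -[RHS]a1; congr ('d _ _ _).
  by apply: rV2P; rewrite !mxE /=; ring.
- rewrite -[RHS]a2; congr ('d _ _ _).
  by apply: rV2P; rewrite !mxE /=; ring.
Qed.

(** On the diagonal consistency dictates the point of the tangent line. *)
Definition meeting_point P tau1 tau2 : 'rV[R]_2 :=
  if tau1 == tau2 then tau1 else
  xget tau1 (tangent_line (isobar e S P) tau1 `&` tangent_line (isobar e S P) tau2).

(** The first and third components solve
    reduced V (meeting_flux U1 U2) = V *: (q + row2 0 P); the second is V times
    the first, up to the constant P required by consistency. *)
Definition meeting_flux U1 U2 : 'rV[R]_3 :=
  let V := velocity U1 in let P := pressure e S (tau_of U1) in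
  let q := meeting_point P (tau_of U1) (tau_of U2) in
  row3 (V * q 0 0) (V * (V * q 0 0) + P)
       (V * (q 0 1 + P) + 2^-1 * V ^+ 2 * (V * q 0 0)).

Lemma reduced_meeting_flux P V U1 U2 : equilibrium_states e S P V U1 ->
  reduced V (meeting_flux U1 U2) =
  V *: (meeting_point P (tau_of U1) (tau_of U2) + row2 0 P).
Proof.
by case=> _ pU vU; rewrite /meeting_flux pU vU; apply: rV2P; rewrite !mxE /=; ring.
Qed.

Lemma consistent_meeting_flux : consistent e S meeting_flux.
Proof.
move=> U /S_U_tau[_ U0]; rewrite /meeting_flux /meeting_point eqxx.
have Un0 : U 0 0 != 0 by rewrite gt_eqF.
apply: rV3P; rewrite !mxE /=; first by rewrite mulrC.
  by ring.
by rewrite /velocity; field.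
Qed.

Section Meet.
Hypothesis meet : forall P, 0 < P -> isobar e S P !=set0 ->
  forall tau1 tau2, isobar e S P tau1 -> isobar e S P tau2 ->
  tangent_line (isobar e S P) tau1 `&` tangent_line (isobar e S P) tau2 !=set0.

Lemma meeting_pointP P tau1 tau2 : 0 < P -> isobar e S P tau1 -> isobar e S P tau2 ->
  'd (pressure e S) tau1 (meeting_point P tau1 tau2 - tau1) = 0 /\
  'd (pressure e S) tau2 (meeting_point P tau1 tau2 - tau2) = 0.
Proof.
move=> P0 h1 h2; rewrite /meeting_point; case: eqP => [<-|_].
  by rewrite subrr linear0.
have hne : isobar e S P !=set0 by exists tau1.
have [q hq] := meet P0 hne h1 h2.
by have [/(tangent_lineE _ h1) a1 /(tangent_lineE _ h2) a2] := xgetPex tau1 (ex_intro _ q hq).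
Qed.

Lemma meeting_flux_preserving : pressure_equilibrium_preserving e S meeting_flux.
Proof.
move=> P V P0 UR UC UL hR hC hL; apply/(equilibrium_preserved_tangent _ hC).
split.
  have [_ pR vR] := hR; have [_ pC vC] := hC.
  by rewrite /flux_difference /meeting_flux pR vR pC vC !mxE /=; ring.
apply/(tangent_spaceE hS _ (equilibrium_isobar hC)).
rewrite /flux_difference reducedB (reduced_meeting_flux _ hR) (reduced_meeting_flux _ hC).
have gR := equilibrium_isobar hR; have gC := equilibrium_isobar hC.
have gL := equilibrium_isobar hL.
have [_ a1] := meeting_pointP P0 gR gC; have [a2 _] := meeting_pointP P0 gC gL.
rewrite -scalerBr linearZ.
set q := meeting_point _ _ _ in a1 *; set q' := meeting_point _ _ _ in a2 *.
have -> : q + row2 0 P - (q' + row2 0 P) = (q - tau_of UC) - (q' - tau_of UC).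
  by apply: rV2P; rewrite !mxE /=; ring.
by rewrite linearB a1 a2 subrr; exact: mulr0.
Qed.

End Meet.
End FluxRegime.
End Fluxes.

Unset Implicit Arguments.
Set Strict Implicit.

Theorem theorem1 (R : realType) (sigma_min : R) (e : 'rV[R]_2 -> R)
    (S_eta : set 'rV[R]_2)
    (he : equation_of_state sigma_min e)
    (hS : admissible_regime sigma_min e S_eta) :
  (exists fh : 'rV[R]_3 -> 'rV[R]_3 -> 'rV[R]_3,
      consistent e S_eta fh /\ pressure_equilibrium_preserving e S_eta fh)
  <->
  (forall P : R, 0 < P -> isobar e S_eta P !=set0 ->
     forall tau1 tau2 : 'rV[R]_2,
       isobar e S_eta P tau1 -> isobar e S_eta P tau2 ->
       tangent_line (isobar e S_eta P) tau1 `&`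
       tangent_line (isobar e S_eta P) tau2 !=set0).
Proof.
split=> [[fh [hc hp]] P P0 _ tau1 tau2 h1 h2|meet].
  exact: (preserving_tangent_lines_meet hS hc hp).
exists (meeting_flux e S_eta); split; first exact: (consistent_meeting_flux hS).
exact: (meeting_flux_preserving hS meet).
Qed.
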